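(* Let $r\ge1$ be an integer. There is a constant $C_r>0$ such that for every finite nonempty $B\subset\mathbb{R}/\mathbb{Z}$ and every $A\subset B$, the number of distinct consecutive $r$--differences of $A$ is at most $$C_r\,|B|^{1-\frac{1}{r+1}}\,\frac{|A+B|}{|B|}+r.$$ One may choose $C_r=\dfrac{2r^{1-\frac{1}{r+1}}}{(r+1)!^{\frac{1}{r+1}}}$.
   Context: $\mathbb{R}/\mathbb{Z}$ is identified with $[0,1)$ with its natural order; $A+B=\{a+b:a\in A,b\in B\}$ computed in $\mathbb{R}/\mathbb{Z}$. Writing $A=\{a_1<\dots<a_k\}$, the distinct consecutive $r$--differences of $A$ are the elements of $D_r(A)=\{(a_{i+1}-a_i,\dots,a_{i+r}-a_{i+r-1}):1\le i\le k-r\}$ (differences in $\mathbb{R}/\mathbb{Z}$), and the claim bounds $|D_r(A)|$. *)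

(* Defs.v *)
From HB Require Import structures.
From mathcomp Require Import all_boot all_order all_algebra archimedean.
From mathcomp Require Import finmap reals exp.

Set Implicit Arguments.
Unset Strict Implicit.
Unset Printing Implicit Defensive.

Import Order.TTheory GRing.Theory Num.Theory.
Local Open Scope fset_scope.
Local Open Scope ring_scope.

(* R/Z on its fundamental domain [0, 1): the group law is addition modulo 1
   and the order is the restriction of the order of R. *)
Record circle (R : realType) := Circle {
  circle_val : R;
  circle_valP : 0 <= circle_val < 1 }.

HB.instance Definition _ (R : realType) := [isSub for @circle_val R].
HB.instance Definition _ (R : realType) := [Choice of circle R by <:].

Fact circle_display : Order.disp_t. Proof. exact: Order.Disp tt tt. Qed.

HB.instance Definition _ (R : realType) :=
  [SubChoice_isSubOrder of circle R by <: with circle_display].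

Section CircleGroup.
Variable R : realType.
Implicit Types (x y : R) (a b c : circle R).

Lemma frac_itv x : 0 <= x - (Num.floor x)%:~R < 1.
Proof.
have /andP[le_fx lt_xf] := floor_itv x.
by rewrite subr_ge0 le_fx ltrBlDl addrC -[1]/(1%:~R) -intrD addrC.
Qed.

Definition circle_pi x : circle R := Circle (frac_itv x).

Lemma circle_piDz x (z : int) : circle_pi (x + z%:~R) = circle_pi x.
Proof.
apply: val_inj => /=.
by rewrite floorDrz ?intr_int// intrKfloor intrD opprD addrACA subrr addr0.
Qed.

Lemma circle_valK : cancel (@circle_val R) circle_pi.
Proof.
move=> a; apply: val_inj => /=.
by rewrite (@floor_def _ _ 0) ?subr0// add0r circle_valP.
Qed.

Definition circle_zero := circle_pi 0.
Definition circle_add a b := circle_pi (circle_val a + circle_val b).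
Definition circle_opp a := circle_pi (- circle_val a).

Lemma circle_piDl x y : circle_pi (circle_val (circle_pi x) + y) = circle_pi (x + y).
Proof. by rewrite /= addrAC -intrN circle_piDz. Qed.

Lemma circle_addC : commutative circle_add.
Proof. by move=> a b; rewrite /circle_add addrC. Qed.

Lemma circle_addA : associative circle_add.
Proof.
move=> a b c; rewrite circle_addC /circle_add !circle_piDl.
by congr circle_pi; rewrite addrC addrA.
Qed.

Lemma circle_add0 : left_id circle_zero circle_add.
Proof. by move=> a; rewrite /circle_add circle_piDl add0r circle_valK. Qed.

Lemma circle_addN : left_inverse circle_zero circle_opp circle_add.
Proof. by move=> a; rewrite /circle_add circle_piDl addNr. Qed.

HB.instance Definition _ := GRing.isZmodule.Build (circle R)
  circle_addA circle_addC circle_add0 circle_addN.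

End CircleGroup.

Section ConsecutiveDifferences.
Variable R : realType.
Implicit Types (A B : {fset circle R}).

Definition sumset A B : {fset circle R} := [fset a + b | a in A, b in B].

(* Indices are shifted to start at 0; the truncated subtraction makes
   the set empty when #|` A| <= r. *)
Definition consecutive_differences (r : nat) A : {fset r.-tuple (circle R)} :=
  let s := sort <=%O A in
  [fset [tuple s`_(i + j).+1%N - s`_(i + j)%N | j < r] | i in iota 0 (#|` A| - r)].

End ConsecutiveDifferences.

(* Main.v *)
(** Pick one index [i] for each distinct [r]-difference of
    [A = {s_0 < s_1 < ...}], and for [b] in [B] let the span of [(i, b)] be the
    number of points of [S = A + B] in the arc [(s_i + b, s_(i+r) + b]].  For
    fixed [b] every point of [S] is in at most [r] of these arcs, so the total
    span is at most [r |S| |B|].  On the other hand a pair of span at most [t]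
    is determined by its starting point [s_i + b] in [S] together with an
    [r]-subset of the [t] points of [S] that follow it, so there are at most
    [|S| 'C(t, r)] such pairs.  Summing over [t < T] gives
    [T |D| |B| <= r |S| |B| + |S| 'C(T, r+1)], and the theorem follows with [T]
    just above [(r |B| (r+1)!) ^ (1/(r+1))]. *)
Require Import Defs.
From mathcomp Require Import all_boot all_order all_algebra archimedean.
From mathcomp Require Import finmap reals exp zify ring.

Import Order.TTheory GRing.Theory Num.Theory.
Local Open Scope fset_scope.
Local Open Scope ring_scope.

(** * Binomial sums, ranks and windows in ordered sets *)

Lemma sum_bin_upper (r T : nat) : (\sum_(t < T) 'C(t, r) = 'C(T, r.+1))%N.
Proof.
elim: T => [|T IHT]; first by rewrite big_ord0.
by rewrite big_ord_recr /= IHT binS addnC.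
Qed.

(** Pulled back to the finite type [V], the sets [P i] become distinct draws of [r] elements, which
    [card_draws] counts. *)
Lemma size_le_bin (K : choiceType) (I : eqType) (V : {fset K}) (r : nat)
    (D : seq I) (P : I -> {fset K}) :
    uniq D -> {in D &, injective P} ->
    {in D, forall i, P i `<=` V} -> {in D, forall i, #|` P i| = r} ->
  (size D <= 'C(#|` V|, r))%N.
Proof.
move=> uD injP subP cardP.
pose F i := [set u : V | val u \in P i].
have FE i : i \in D -> P i = [fset val u | u in F i].
  move=> iD; apply/fsetP => x; apply/idP/imfsetP => /= [xP | [u]]; last first.
    by rewrite inE => uP ->.
  by exists [` (fsubsetP (subP i iD)) x xP] => //; rewrite inE.
have injF : {in D &, injective F}.
  by move=> i j iD jD eqF; apply: injP => //; rewrite FE // (FE j) // eqF.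
rewrite cardfE -card_draws cardE -(size_map F).
apply: uniq_leq_size; first by rewrite map_inj_in_uniq.
move=> _ /mapP[i iD ->]; rewrite mem_enum inE.
by rewrite -(cardP i iD) (FE i iD) card_imfset ?cardE //; apply: val_inj.
Qed.

(** If [m] is the largest selected element, every selected element is [<= m], and the rank of [m] is
    at most [t]. *)
Lemma card_initial_segment d (K : orderType d) (U : {fset K}) (t : nat) :
  (#|` [fset u in U | (#|` [fset w in U | (w <= u)%O]| <= t)%N]| <= t)%N.
Proof.
set V := [fset u in U | _].
have [-> //|[v vV]] := fset_0Vmem V.
case: (@arg_maxP _ _ V [` vV] xpredT val) => // m _ mP.
have := fsvalP m; rewrite !inE => /andP[_ /(leq_trans _)]; apply.
apply: fsubset_leq_card; apply/fsubsetP => u uV; rewrite !inE.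
have := uV; rewrite !inE => /andP[-> _] /=; exact: (mP [` uV]).
Qed.

(** Let [m] be the first position with an entry [>= x]. The two inequalities force [i < m <= i + r],
    which leaves [r] consecutive values of [i]. *)
Lemma count_windows d (K : orderType d) (x0 : K) (s : seq K) (x : K) (r : nat)
    (I : seq nat) :
    sorted <=%O s -> uniq I -> {in I, forall i, i + r < size s}%N ->
  (count (fun i => (nth x0 s i < x <= nth x0 s (i + r))%O) I <= r)%N.
Proof.
move=> s_sorted uI ltI.
pose m := find (fun y => (x <= y)%O) s.
rewrite -size_filter -[leqRHS](size_iota (m - r)).
apply: uniq_leq_size => [|i]; first exact: filter_uniq.
rewrite mem_filter mem_iota => /andP[/andP[lt_ix le_xi] /ltI ltis].
have le_m : (m <= i + r)%N.
  by rewrite leqNgt; apply/negP => /(before_find x0); rewrite le_xi.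
have lt_m : (i < m)%N.
  rewrite ltnNge; apply/negP => le_mi.
  have ms : (m < size s)%N by apply: leq_ltn_trans ltis.
  have /(nth_find x0) : has (fun y => (x <= y)%O) s by rewrite has_find.
  rewrite leNgt => /negP; apply; apply: le_lt_trans lt_ix.
  have si : (i < size s)%N by apply: leq_ltn_trans ltis; apply: leq_addr.
  exact: le_sorted_leq_nth.
by rewrite leq_subLR addnC le_m -ltn_subLR ?subKn; lia.
Qed.

(** * Order of the circle under translation *)

Section CircleOrder.
Variable R : realType.
Implicit Types a d u x y : circle R.

Lemma circle_leE x y : (x <= y)%O = (circle_val x <= circle_val y).
Proof. exact: leEsub. Qed.

Lemma circle_piK (t : R) : 0 <= t < 1 -> circle_val (circle_pi t) = t.
Proof. by move=> h; have /(congr1 (@circle_val R)) := circle_valK (Circle h). Qed.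

(** Nothing wraps around: the real difference already lies in [[0, 1)]. *)
Lemma circle_valB a x : (a <= x)%O ->
  circle_val (x - a) = circle_val x - circle_val a.
Proof.
move=> le_ax.
have -> : x - a = circle_pi (circle_val x - circle_val a).
  by rewrite [LHS]addrC [LHS]circle_piDl addrC.
apply: circle_piK; move: le_ax; rewrite subr_ge0 circle_leE => ->.
have /andP[_] := circle_valP x; apply: le_lt_trans.
by have /andP[a_ge0 _] := circle_valP a; rewrite lerBlDr lerDl.
Qed.

Lemma circle_leB a x y : (a <= x)%O -> (a <= y)%O ->
  (x - a <= y - a)%O = (x <= y)%O.
Proof.
by move=> le_ax le_ay; rewrite !circle_leE !circle_valB // lerD2r.
Qed.

Lemma circle_ltB a x y : (a <= x)%O -> (a <= y)%O ->
  (x - a < y - a)%O = (x < y)%O.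
Proof. by move=> le_ax le_ay; rewrite !ltNge circle_leB. Qed.

(** As reals, [u + a] is at most [d < 1], so the sum does not wrap around; [u != 0] makes the left
    inequality strict. *)
Lemma circle_addr_itv a d u : (a <= d)%O -> u != 0 -> (u <= d - a)%O ->
  (a < u + a <= d)%O.
Proof.
move=> le_ad u_neq0 le_ud.
have le_vu : circle_val u <= circle_val d - circle_val a.
  by rewrite -circle_valB // -circle_leE.
have h : 0 <= circle_val u + circle_val a < 1.
  rewrite addr_ge0 ?(andP (circle_valP _)).1 //=.
  by apply: le_lt_trans (andP (circle_valP d)).2; rewrite -lerBrDr.
have vE : circle_val (u + a) = circle_val u + circle_val a.
  exact: circle_piK.
have le_aua : (a <= u + a)%O.
  by rewrite circle_leE vE lerDr (andP (circle_valP u)).1.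
rewrite lt_neqAle le_aua andbT; apply/andP; split.
  by apply: contra_neq u_neq0 => aE; apply: (addIr a); rewrite -aE add0r.
by rewrite circle_leE vE -lerBrDr.
Qed.

End CircleOrder.

Lemma mem_sumset (R : realType) (A B : {fset circle R}) (a b : circle R) :
  a \in A -> b \in B -> a + b \in sumset A B.
Proof. by move=> aA bB; apply/imfset2P; exists a => //; exists b. Qed.

(** * Counting pairs [(i, b)] by their span *)

Section DoubleCounting.
Variables (R : realType) (r : nat) (A B : {fset circle R}).
Let s : seq (circle R) := sort <=%O A.
Let S := sumset A B.
Variable I : seq nat.
Hypothesis uniqI : uniq I.
Hypothesis ltI : {in I, forall i, i + r < size s}%N.

Definition window (i : nat) : r.-tuple (circle R) :=
  [tuple s`_(i + j).+1%N - s`_(i + j)%N | j < r].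

(** The test is made on [c - b] because the arc translated by [b] may wrap around 0, while the
    original one does not. *)
Definition span (i : nat) (b : circle R) : nat :=
  #|` [fset c in S | (s`_i < c - b <= s`_(i + r)%N)%O]|.

(** These are the partial sums of [window i]. *)
Definition offsets (i : nat) : {fset circle R} :=
  [fset x in [seq s`_(i + j)%N - s`_i | j <- iota 1 r]].

(** Subtracting [c] turns the cyclic order starting from [c] into the order of the circle; removing
    0 leaves out [c] itself. *)
Definition translate (c : circle R) : {fset circle R} :=
  [fset c' - c | c' in S] `\ 0.

(** The first [t] points of [S] after [c], recorded relative to [c]; with the rank condition this is
    all of them when there are fewer than [t]. *)
Definition initial_segment (t : nat) (c : circle R) : {fset circle R} :=
  [fset u in translate c
    | (#|` [fset w in translate c | (w <= u)%O]| <= t)%N].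

Let sorted_s : sorted <%O s.
Proof. by rewrite sort_lt_sorted fset_uniq. Qed.

Let lt_s i j j' : i \in I -> (j < j' <= r)%N -> (s`_(i + j)%N < s`_(i + j')%N)%O.
Proof.
move=> /ltI lti /andP[jj' j'r].
have lt_j' : (i + j' < size s)%N by apply: leq_ltn_trans lti; rewrite leq_add2l.
rewrite lt_sorted_ltn_nth ?inE ?ltn_add2l //.
by apply: ltn_trans lt_j'; rewrite ltn_add2l.
Qed.

Let le_s i j : i \in I -> (j <= r)%N -> (s`_i <= s`_(i + j)%N)%O.
Proof.
case: j => [|j] iI jr; first by rewrite addn0.
by apply: ltW; rewrite -[i in X in (X < _)%O]addn0; apply: lt_s.
Qed.

Let sorted_offsets i : i \in I ->
  sorted <%O [seq s`_(i + j)%N - s`_i | j <- iota 1 r].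
Proof.
move=> iI; apply: (@homo_sorted_in _ _ (fun j => j <= r)%N _ ltn).
- by move=> j j' jr j'r /= jj'; rewrite circle_ltB ?le_s // lt_s // jj'.
- by apply/allP => j; rewrite mem_iota add1n ltnS => /andP[].
- exact: iota_ltn_sorted.
Qed.

Lemma card_offsets : {in I, forall i, #|` offsets i| = r}.
Proof.
move=> i iI; rewrite /offsets card_fseq undup_id ?size_map ?size_iota //.
exact/lt_sorted_uniq/sorted_offsets.
Qed.

(** Sorting recovers the sequence of offsets from the set, and differences of successive offsets,
    starting from offset 0, recover the window. *)
Lemma offsets_inj : {in I &, injective window} -> {in I &, injective offsets}.
Proof.
move=> injw i i' iI i'I eqo; apply: injw => //.
have /eq_in_map eqs : [seq s`_(i + j)%N - s`_i | j <- iota 1 r]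
    = [seq s`_(i' + j)%N - s`_i' | j <- iota 1 r].
  apply: lt_sorted_eq; rewrite ?sorted_offsets // => x.
  by move/fsetP/(_ x): eqo; rewrite !inE.
have {}eqs j : (j <= r)%N -> s`_(i + j)%N - s`_i = s`_(i' + j)%N - s`_i'.
  case: j => [|j] jr; first by rewrite !addn0 !subrr.
  by apply: eqs; rewrite mem_iota add1n ltnS.
apply: eq_from_tnth => j; rewrite !tnth_mktuple -!addnS.
have subE k l : s`_k - s`_l = (s`_k - s`_i) - (s`_l - s`_i).
  by rewrite opprB addrA subrK.
by rewrite subE !eqs ?(ltnW (ltn_ord j)) // opprB addrA subrK.
Qed.

(** After exchanging the sums, [count_windows] applies to each point [c - b]. *)
Lemma sum_span b : (\sum_(i <- I) span i b <= r * #|` S|)%N.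
Proof.
rewrite /span; under eq_bigr do rewrite card_fset_sum1 big_fset /= big_mkcond /=.
rewrite exchange_big /= mulnC card_fset_sum1 big_distrl /=.
apply: leq_sum => c _; rewrite mul1n -big_mkcond sum1_count.
by apply: count_windows => //; apply: sub_sorted sorted_s => x y /ltW.
Qed.

Lemma offsets_sub i b t : i \in I -> b \in B -> (span i b <= t)%N ->
  offsets i `<=` initial_segment t (s`_i + b).
Proof.
move=> iI bB le_t; apply/fsubsetP => x; rewrite inE => /mapP[j].
rewrite mem_iota add1n ltnS => /andP[j_gt0 jr] ->{x}.
have sA k : (k <= r)%N -> s`_(i + k)%N \in A.
  move=> kr; rewrite -(mem_sort <=%O) mem_nth //.
  by apply: leq_ltn_trans (ltI _ iI); rewrite leq_add2l.
have lt_ij : (s`_i < s`_(i + j)%N)%O.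
  by rewrite -[i in X in (X < _)%O]addn0 lt_s // j_gt0.
rewrite !inE subr_eq0 gt_eqF //=; apply/andP; split.
  apply/imfsetP; exists (s`_(i + j)%N + b) => /=; last first.
    by rewrite [s`_i + b]addrC addrKA.
  by apply: mem_sumset => //; apply: sA.
(* Adding [s_i + b] carries the points of rank at most that of the [j]-th offset into the set
   counted by [span i b]. *)
have card_shift (X : {fset circle R}) :
    #|` [fset w + (s`_i + b) | w in X]| = #|` X|.
  by apply: card_imfset; apply: addIr.
apply: leq_trans le_t; rewrite -card_shift.
apply: fsubset_leq_card; apply/fsubsetP => _ /imfsetP[w /= wP ->].
move: wP; rewrite !inE => /andP[/andP[w_neq0 /imfsetP[c /= cS wE]] le_w].
rewrite {1}wE subrK cS addrA addrK /=.
apply: circle_addr_itv; rewrite ?le_s // (le_trans le_w) //.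
rewrite circle_leB ?le_s //.
move: jr; rewrite leq_eqVlt => /predU1P[-> //|jr].
by rewrite ltW // lt_s // jr leqnn.
Qed.

Lemma count_small_span t : {in I &, injective window} ->
  (\sum_(i <- I) count (fun b => span i b <= t) B <= #|` S| * 'C(t, r))%N.
Proof.
move=> injw.
pose good i c := offsets i `<=` initial_segment t c.
(* For fixed [i], the starting point [s_i + b] determines [b]. *)
have le_good i : i \in I ->
    (count (fun b => (span i b <= t)%N) B <= count (good i) S)%N.
  move=> iI; rewrite -!size_filter -(size_map (fun b => s`_i + b)).
  apply: uniq_leq_size.
    by rewrite (map_inj_uniq (addrI _)) filter_uniq ?fset_uniq.
  move=> _ /mapP[b + ->]; rewrite !mem_filter => /andP[le_t bB].
  rewrite /good (offsets_sub _ _ _ iI bB le_t); apply: mem_sumset => //.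
  by rewrite -(mem_sort <=%O) mem_nth // (leq_ltn_trans (leq_addr r i) (ltI _ iI)).
apply: (@leq_trans (\sum_(i <- I) count (good i) S)).
  by rewrite big_seq [leqRHS]big_seq; apply: leq_sum => i; apply: le_good.
under eq_bigr do rewrite -sum1_count big_mkcond /=.
rewrite exchange_big /= card_fset_sum1 big_distrl /=.
apply: leq_sum => c _; rewrite mul1n -big_mkcond sum1_count -size_filter.
(* For fixed [c], the good indices give distinct [r]-subsets of a set of at most [t] points. *)
have le_t : (#|` initial_segment t c| <= t)%N by apply: card_initial_segment.
apply: leq_trans (leq_bin2l r le_t); apply: (@size_le_bin _ _ _ _ _ offsets).
- exact: filter_uniq.
- move=> i j; rewrite !mem_filter => /andP[_ iI] /andP[_ jI].
  exact: offsets_inj.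
- by move=> i; rewrite mem_filter => /andP[].
- by move=> i; rewrite mem_filter => /andP[_ /card_offsets].
Qed.

Lemma double_counting T : {in I &, injective window} ->
  (T * (size I * #|` B|) <= r * #|` S| * #|` B| + #|` S| * 'C(T, r.+1))%N.
Proof.
move=> injw.
(* Layer-cake bound, applied with [m] a span: if [m < T], exactly [T - m] values of [t] satisfy
   [m <= t < T]. *)
have layer m : (T <= m + \sum_(t < T) (m <= t))%N.
  elim: T => // T' IH; rewrite big_ord_recr /= addnA.
  case: (leqP m T') => [_|lt_m] /=; first by rewrite addn1.
  by rewrite addn0 (leq_trans lt_m) // leq_addr.
apply: (@leq_trans (\sum_(i <- I) \sum_(b <- B)
    (span i b + \sum_(t < T) (span i b <= t)))).
  rewrite mulnC -mulnA -sum1_size big_distrl /=; apply: leq_sum => i _.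
  rewrite mul1n -sum1_size big_distrl /=; apply: leq_sum => b _.
  by rewrite mul1n.
under eq_bigr do rewrite big_split /=.
rewrite big_split /= leq_add //.
  rewrite exchange_big mulnC -sum1_size big_distrl /=.
  by apply: leq_sum => b _; rewrite mul1n sum_span.
under eq_bigr do rewrite exchange_big /=.
rewrite exchange_big /= -sum_bin_upper big_distrr /=.
apply: leq_sum => t _; apply: leq_trans (count_small_span t injw).
by apply: eq_leq; apply: eq_bigr => i _; rewrite -sum1_count [RHS]big_mkcond.
Qed.

End DoubleCounting.

(** * Representative indices and choice of the threshold *)

Lemma window_transversal (R : realType) (r : nat) (A : {fset circle R}) :
  exists I : seq nat,
    [/\ uniq I, {in I, forall i, i + r < size (sort <=%O A)}%N,
        {in I &, injective (window R r A)}
      & size I = #|` consecutive_differences r A|].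
Proof.
pose J := iota 0 (#|` A| - r); pose W := map (window R r A) J.
have DW v : v \in consecutive_differences r A -> v \in W.
  by case/imfsetP => i /= iJ ->; apply: map_f.
(* [J] starts at 0, so the position of [v] in [W] is itself an index whose window is [v]. *)
have wK : {in consecutive_differences r A, cancel (index^~ W) (window R r A)}.
  move=> v /DW vW; have ltv : (index v W < #|` A| - r)%N.
    by move: vW; rewrite -index_mem size_map size_iota.
  rewrite -[RHS](nth_index v vW) (nth_map 0%N) ?size_iota //.
  by rewrite nth_iota ?add0n.
exists [seq index v W | v <- consecutive_differences r A]; split.
- by rewrite map_inj_in_uniq ?fset_uniq //; apply: can_in_inj wK.
- move=> _ /mapP[v /DW vW ->]; rewrite size_sort addnC -ltn_subRL.
  by move: vW; rewrite -index_mem size_map size_iota.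
- move=> _ _ /mapP[v vD ->] /mapP[w wD ->]; rewrite !wK // => -> //.
- by rewrite size_map.
Qed.

(** The equation for [x] balances [r n m] against [n x^(r+1) / (r+1)!]. With [T - 1 <= x < T], each
    term is at most [n T (r m / x)], whence the factor 2. *)
Lemma threshold_bound (R : realType) (r d m n : nat) (x : R) :
    0 < x -> (0 < m)%N -> x ^+ r.+1 = r%:R * m%:R * r.+1`!%:R ->
    (forall T, T * (d * m) <= r * n * m + n * 'C(T, r.+1))%N ->
  d%:R <= 2 * n%:R * r%:R / x.
Proof.
move=> x_gt0 m_gt0 xE countT; pose T := (Num.trunc x).+1.
have /andP[le_Tx lt_xT] := trunc_itv (ltW x_gt0).
have m_gt0' : 0 < m%:R :> R by rewrite ltr0n.
have F_gt0 : 0 < r.+1`!%:R :> R by rewrite ltr0n fact_gt0.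
have T_gt0 : 0 < T%:R :> R by rewrite ltr0n.
have ffact_le k j : (k ^_ j <= k ^ j)%N.
  by elim: j => // j IH; rewrite ffactnSr expnSr leq_mul // leq_subr.
(* Here ['C(T, r+1) (r+1)!] is [T] times a falling factorial of [T - 1], hence at most [T x^r]. *)
have le_bin : 'C(T, r.+1)%:R <= T%:R * (r%:R * m%:R / x).
  rewrite -(ler_pM2r F_gt0) -[leLHS]natrM bin_ffact ffactSS natrM -!mulrA ler_pM2l //.
  have -> : r%:R * (m%:R * (x^-1 * r.+1`!%:R)) = x ^+ r.
    rewrite [RHS](_ : _ = x ^+ r.+1 / x); last by rewrite exprSr mulfK ?gt_eqF.
    by rewrite xE -!mulrA [_^-1 * _]mulrC.
  apply: (@le_trans _ _ ((Num.trunc x)%:R ^+ r)).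
    by rewrite -natrX ler_nat.
  by rewrite lerXn2r // nnegrE ?ler0n // ltW.
have le_rm : r%:R * m%:R <= T%:R * (r%:R * m%:R / x).
  by rewrite mulrCA ler_peMr ?mulr_ge0 ?ler0n // ler_pdivlMr ?mul1r ?ltW.
have := countT T; rewrite -(ler_nat R) natrD !natrM => count_le.
rewrite -(ler_pM2r m_gt0') -(ler_pM2l T_gt0); apply: le_trans count_le _.
have -> : T%:R * (2 * n%:R * r%:R / x * m%:R)
    = n%:R * (T%:R * (r%:R * m%:R / x) + T%:R * (r%:R * m%:R / x)) by ring.
have -> : r%:R * n%:R * m%:R + n%:R * 'C(T, r.+1)%:R
    = n%:R * (r%:R * m%:R + 'C(T, r.+1)%:R) :> R by ring.
by rewrite ler_wpM2l ?ler0n // lerD.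
Qed.

Theorem theorem3p5 (R : realType) (r : nat) (r_ge1 : (1 <= r)%N) :
  exists C : R,
    [/\ 0 < C,
        forall B A : {fset circle R}, B != fset0 -> A `<=` B ->
          (#|` consecutive_differences r A|)%:R
            <= C * (#|` B|%:R `^ (1 - 1 / r.+1%:R))
                 * (#|` sumset A B|%:R / #|` B|%:R) + r%:R
      & C = 2 * (r%:R `^ (1 - 1 / r.+1%:R)) / ((r.+1)`!%:R `^ (1 / r.+1%:R))].
Proof.
set e : R := 1 / r.+1%:R.
have r_gt0 : 0 < r%:R :> R by rewrite ltr0n.
have F_gt0 : 0 < r.+1`!%:R :> R by rewrite ltr0n fact_gt0.
have powRBe (y : R) : 0 < y -> y `^ (1 - e) = y / y `^ e.
  by move=> y_gt0; rewrite powRB ?powRr1 ?(ltW y_gt0) // (gt_eqF y_gt0) implybT.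
exists (2 * r%:R `^ (1 - e) / r.+1`!%:R `^ e); split => //.
  by rewrite divr_gt0 ?mulr_gt0 ?powR_gt0.
move=> B A; rewrite -cardfs_gt0 => B_gt0 _.
have m_gt0 : 0 < #|` B|%:R :> R by rewrite ltr0n.
pose x := (r%:R * #|` B|%:R * r.+1`!%:R) `^ e.
have x_gt0 : 0 < x by rewrite powR_gt0 ?mulr_gt0.
have xE : x ^+ r.+1 = r%:R * #|` B|%:R * r.+1`!%:R.
  rewrite -powR_mulrn ?ltW // -powRrM divfK ?pnatr_eq0 //.
  by rewrite powRr1 // ltW ?mulr_gt0.
have [I [uI ltI injI sizeI]] := window_transversal R r A.
have := threshold_bound R r _ _ #|` sumset A B| x x_gt0 B_gt0 xE
  (fun T => double_counting R r A B I uI ltI T injI).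
rewrite sizeI => /le_trans; apply; apply: ler_wpDr; first by rewrite ler0n.
have -> : x = r%:R `^ e * #|` B|%:R `^ e * r.+1`!%:R `^ e.
  by rewrite /x !powRM ?mulr_ge0 ?ler0n.
(* Once each power [1 - e] is written as a quotient, both sides are rational in the [e]-th powers
   and [field] applies. *)
rewrite !powRBe //.
rewrite le_eqVlt; apply/orP; left; apply/eqP.
field.
by do ?[apply/andP; split]; rewrite gt_eqF ?powR_gt0.
Qed.
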